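(* Consider probabilistic direct search (PDS, as described in the context) with $f:\mathbb{R}^n\to\mathbb{R}$ differentiable and convex on $\mathbb{R}^n$. Let $p_*=\dfrac{\log\gamma}{\log(\theta^{-1}\gamma)}$. Suppose that $\{\mathfrak{D}_k\}$ is a sequence of $p$-probabilistic ascent sets with $p>p_*$. Then $$\mathbb{P}\Big(\inf_{k\ge 0}\mu(X_k)>0\Big)>0$$ for any function $\mu:\mathbb{R}^n\to(-\infty,\infty]$ that is lower semicontinuous with $\mu(x_0)>0$. In particular, the conclusion holds if $\mu$ is $f(\cdot)-\inf f$, $\operatorname{gap}(\,\cdot\,,\mathcal{S}(f))$, or $\|\nabla f(\cdot)\|$, and $x_0$ is not a stationary point of $f$ (i.e. $\nabla f(x_0)\neq 0$).
   Context: PDS. Fix $n\ge 1$, an objective $f:\mathbb{R}^n\to\mathbb{R}$, a deterministic starting point $x_0\in\mathbb{R}^n$, a deterministic initial step size $\alpha_0>0$, constants $\theta\in(0,1)$ and $\gamma\in[1,\infty)$, and a forcing function $\rho:(0,\infty)\to(0,\infty)$, which is nondecreasing with $\rho(\alpha)=o(\alpha)$ as $\alpha\to 0^+$. On a probability space $(\Omega,\mathcal{F},\mathbb{P})$, PDS generates random polling direction sets $\mathfrak{D}_k$, random iterates $X_k$ and random step sizes $A_k$, $k\ge 0$, with $X_0=x_0$, $A_0=\alpha_0$, as follows. For each $k\ge 0$, $\mathfrak{D}_k$ is nonempty and consists of finitely many random vectors in $\mathbb{R}^n$ of Euclidean norm $1$. If some $d\in\mathfrak{D}_k$ satisfies $f(X_k)-f(X_k+A_kd)>\rho(A_k)$,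 then $X_{k+1}=X_k+A_kd_k$ for some $d_k\in\mathfrak{D}_k$ satisfying this inequality (the selection rule is unspecified and may involve additional randomness) and $A_{k+1}=\gamma A_k$; otherwise $X_{k+1}=X_k$ and $A_{k+1}=\theta A_k$. Filtration: $\mathcal{F}_{-1}=\{\emptyset,\Omega\}$ and $\mathcal{F}_k=\sigma(\mathfrak{D}_0,X_1,\dots,\mathfrak{D}_k,X_{k+1})$ for $k\ge 0$. Equalities and inequalities involving conditional probabilities given a $\sigma$-algebra are understood almost surely. Cosine measure: for a finite nonempty set $\mathcal{D}$ of nonzero vectors and $v\ne 0$, $\operatorname{cm}(\mathcal{D},v)=\max_{d\in\mathcal{D}}\frac{d^{\mathsf T}v}{\|d\|\|v\|}$; $\operatorname{cm}(\mathcal{D},0)$ is defined to be an arbitrary fixed constant in $[-1,1]$. Probabilistic ascent: for $f$ continuously differentiable (automatic when $f$ is real-valued, differentiable and convex), let $G_k=\nabla f(X_k)$. For $p\in[0,1]$, $\{\mathfrak{D}_k\}$ is a sequence of $p$-probabilistic ascent sets if $\mathbb{P}(\operatorname{cm}(\mathfrak{D}_k,-G_k)\le 0\mid\mathcal{F}_{k-1})\ge p\,\mathbf{1}(G_k\ne 0)$ for each $k\ge 0$, where $\mathbf{1}$ denotes the indicator of an event. Notation: $\inf f=\inf_{x\in\mathbb{R}^n}f(x)$ (possibly $-\infty$), $\mathcal{S}(f)=\{x\in\mathbb{R}^n: f(x)=\inf f\}$ (possibly empty), $\operatorname{gap}(A,B)=\inf\{\|a-b\|:a\in A,b\in B\}$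 (equal to $\infty$ if $A$ or $B$ is empty), and $\operatorname{gap}(a,B)=\operatorname{gap}(\{a\},B)$. *)

(* Defs.v *)
From HB Require Import structures.
From mathcomp Require Import all_boot all_order all_algebra.
From mathcomp Require Import all_classical all_reals all_analysis.

Set Implicit Arguments.
Unset Strict Implicit.
Unset Printing Implicit Defensive.

Import Order.TTheory GRing.Theory Num.Theory.
Import numFieldNormedType.Exports.

Local Open Scope classical_set_scope.
Local Open Scope ring_scope.

(* The norm of the library on 'rV[R]_n is the sup norm; its topology, Borel sets
   and notion of differentiability are the Euclidean ones, but lengths are not. *)

Definition dotp (R : realType) (n : nat) (u v : 'rV[R]_n) : R :=
  \sum_i u 0 i * v 0 i.

Definition enorm (R : realType) (n : nat) (u : 'rV[R]_n) : R :=
  Num.sqrt (dotp u u).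

Definition grad (R : realType) (n : nat) (f : 'rV[R]_n -> R) (x : 'rV[R]_n)
    : 'rV[R]_n :=
  \row_i 'D_(delta_mx 0 i) (f : 'rV[R]_n -> R^o) x.

(* A finite set of directions is given by a list enumerating it. The default
   value -1 of the maximum is a lower bound of every cosine, so it is harmless
   for nonempty lists. [c0] is the conventional value at v = 0. *)
Definition cm (R : realType) (n : nat) (c0 : R) (D : seq 'rV[R]_n)
    (v : 'rV[R]_n) : R :=
  if v == 0 then c0
  else \big[Num.max/-1]_(d <- D) (dotp d v / (enorm d * enorm v)).

Definition inff (R : realType) (n : nat) (f : 'rV[R]_n -> R) : \bar R :=
  ereal_inf [set (f x)%:E | x in [set: 'rV[R]_n]].

Definition argmin (R : realType) (n : nat) (f : 'rV[R]_n -> R)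
    : set 'rV[R]_n :=
  [set x | (f x)%:E = inff f].

Definition gap (R : realType) (n : nat) (A B : set 'rV[R]_n) : \bar R :=
  ereal_inf [set (enorm (a - b))%:E | a in A & b in B].

Definition forcing_function (R : realType) (rho : R -> R) : Prop :=
  [/\ forall a, 0 < a -> 0 < rho a,
      forall a b, 0 < a -> a <= b -> rho a <= rho b &
      (fun a => rho a / a) @ 0^'+ --> (0 : R)].

Definition borel (R : realType) (n : nat) : set (set 'rV[R]_n) :=
  <<s @open 'rV[R]_n >>.

Definition random_vector d (T : measurableType d) (R : realType) (n : nat)
    (Y : T -> 'rV[R]_n) : Prop :=
  forall B, borel B -> measurable (Y @^-1` B).

Definition sigma_vec (T : Type) (R : realType) (n : nat) (Y : T -> 'rV[R]_n)
    : set (set T) :=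
  preimage_set_system setT Y (@borel R n).

(* The events on the entries of a random list. Polling directions have norm 1, so
   the padding value 0 is never an entry, and the (possibly random) number of
   entries is itself measurable for the sigma-algebra that these events generate. *)
Definition sigma_seq (T : Type) (R : realType) (n : nat)
    (D : T -> seq 'rV[R]_n) : set (set T) :=
  \bigcup_i sigma_vec (fun w => nth 0 (D w) i).

(* [history D X k] is sigma(D_0, X_1, ..., D_(k-1), X_k), i.e., F_(k-1); for k = 0
   it is the trivial sigma-algebra. *)
Definition history (T : Type) (R : realType) (n : nat)
    (D : nat -> T -> seq 'rV[R]_n) (X : nat -> T -> 'rV[R]_n) (k : nat)
    : set (set T) :=
  <<s \bigcup_(j in [set j | (j < k)%N])
        (sigma_seq (D j) `|` sigma_vec (X j.+1)) >>.

(* [Z] is a version of the conditional probability P(E | F), for a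
   sub-sigma-algebra [F]. *)
Definition cond_prob d (T : measurableType d) (R : realType)
    (P : probability T R) (F : set (set T)) (E : set T) (Z : T -> R) : Prop :=
  [/\ forall B : set R, measurable B -> F (Z @^-1` B),
      P.-integrable setT (EFin \o Z) &
      forall B, F B -> (\int[P]_(w in B) (Z w)%:E = P (E `&` B))%E].

Definition sufficient_decrease (R : realType) (n : nat) (f : 'rV[R]_n -> R)
    (rho : R -> R) (x : 'rV[R]_n) (a : R) (v : 'rV[R]_n) : Prop :=
  rho a < f x - f (x + a *: v).

Record PDS d (T : measurableType d) (R : realType) (n : nat)
    (f : 'rV[R]_n -> R) (x0 : 'rV[R]_n) (alpha0 theta gamma : R)
    (rho : R -> R) (D : nat -> T -> seq 'rV[R]_n) (X : nat -> T -> 'rV[R]_n)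
    (A : nat -> T -> R) : Prop := {
  pds_D_random : forall k i, random_vector (fun w => nth 0 (D k w) i) ;
  pds_D_nonempty : forall k w, D k w <> [::] ;
  pds_D_unit : forall k w v, v \in D k w -> enorm v = 1 ;
  pds_X_random : forall k, random_vector (X k) ;
  pds_A_random : forall k, measurable_fun setT (A k) ;
  pds_X0 : forall w, X 0%N w = x0 ;
  pds_A0 : forall w, A 0%N w = alpha0 ;
  pds_success : forall k w,
    (exists2 v, v \in D k w &
       sufficient_decrease f rho (X k w) (A k w) v) ->
    (exists v, [/\ v \in D k w,
       sufficient_decrease f rho (X k w) (A k w) v &
       X k.+1 w = X k w + A k w *: v]) /\
    A k.+1 w = gamma * A k w ;
  pds_failure : forall k w,
    ~ (exists2 v, v \in D k w &
         sufficient_decrease f rho (X k w) (A k w) v) ->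
    X k.+1 w = X k w /\ A k.+1 w = theta * A k w
}.

Definition probabilistic_ascent d (T : measurableType d) (R : realType)
    (P : probability T R) (n : nat) (f : 'rV[R]_n -> R) (c0 : R)
    (D : nat -> T -> seq 'rV[R]_n) (X : nat -> T -> 'rV[R]_n) (p : R) : Prop :=
  forall k, exists2 Z : T -> R,
    cond_prob P (history D X k)
      [set w | cm c0 (D k w) (- grad f (X k w)) <= 0] Z &
    {ae P, forall w, p * \1_[set w' | grad f (X k w') <> 0] w <= Z w}.

(* Main.v *)
Require Import Defs.
From HB Require Import structures.
From mathcomp Require Import all_boot all_order all_algebra.
From mathcomp Require Import all_classical all_reals all_analysis.
From mathcomp Require Import measurable_realfun.
From mathcomp Require Import ring lra.
Import Order.TTheory GRing.Theory Num.Theory.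
Import numFieldNormedType.Exports.
Local Open Scope classical_set_scope.
Local Open Scope ring_scope.

(** An iteration whose polling directions are all ascent directions is
    unsuccessful when [f] is convex, by the gradient inequality, and so is every
    iteration started at a stationary point. Hence, whatever the past, an
    iteration fails with conditional probability at least [p]
    ([failure_ge]). The condition on [p] says that the logarithm of the
    step-size factor, which is [theta] on failure and [gamma] on success, has
    negative conditional expectation; therefore, for some [s > 0], the factor
    raised to the power [s] has conditional expectation at most some [q < 1]
    ([contracting_exponent]), and once the step size equals [a] it exceeds [c]
    after [j] more iterations with conditional probability at most
    [q ^+ j * (a / c) `^ s] ([step_size_tail]).

    With probability at least [p ^+ K > 0] the first [K] iterations all fail,
    so that the iterate is still [x0] while the step size has dropped to
    [theta ^+ K * alpha0]. For [K] large, the conditional tail bounds for the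
    thresholds [c * r ^+ j], with a suitable [r < 1], sum up to at most one
    half. On an event of positive probability all later step sizes are thus
    bounded by a geometric sequence of small sum, and the iterates never
    leave a given ball around [x0] ([stay_close]). A lower semicontinuous
    function that is positive at [x0] is bounded below by a positive constant
    on a small enough ball, which gives the first part.

    The three particular functions are lower semicontinuous; for the norm of the
    gradient this holds because the gradient of a differentiable convex function
    is continuous ([grad_continuous]). Continuity of the gradient also makes the
    events about ascent directions measurable. *)

(** * Euclidean geometry of row vectors *)

Section Euclidean.
Context {R : realType} {n : nat}.
Implicit Types u v w : 'rV[R]_n.

Lemma dotpC u v : dotp u v = dotp v u.
Proof. by apply: eq_bigr => i _; rewrite mulrC. Qed.

Lemma dotpDl u v w : dotp (u + v) w = dotp u w + dotp v w.
Proof. by rewrite -big_split; apply: eq_bigr => i _; rewrite mxE mulrDl. Qed.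

Lemma dotpZl (a : R) u v : dotp (a *: u) v = a * dotp u v.
Proof.
by rewrite /dotp big_distrr/=; apply: eq_bigr => i _; rewrite mxE mulrA.
Qed.

Lemma dotpNl u v : dotp (- u) v = - dotp u v.
Proof. by rewrite -scaleN1r dotpZl mulN1r. Qed.

Lemma dot0p v : dotp 0 v = 0.
Proof. by rewrite -(scale0r v) dotpZl mul0r. Qed.

Lemma dotp_ge0 u : 0 <= dotp u u.
Proof. by apply: sumr_ge0 => i _; rewrite -expr2 sqr_ge0. Qed.

Lemma enorm_ge0 u : 0 <= enorm u.
Proof. exact: sqrtr_ge0. Qed.

Lemma sqr_enorm u : enorm u ^+ 2 = dotp u u.
Proof. by rewrite sqr_sqrtr ?dotp_ge0. Qed.

Lemma enorm0 : enorm (0 : 'rV[R]_n) = 0.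
Proof. by rewrite /enorm dot0p sqrtr0. Qed.

(** The library norm on row vectors is the sup norm. *)
Lemma norm_le_enorm u : `|u| <= enorm u.
Proof.
rewrite -[leLHS]/(mx_norm u) mx_normrE.
apply/bigmax_leP; split => [|[i j] _ /=].
  exact: enorm_ge0.
rewrite -sqrtr_sqr ler_wsqrtr// (ord1 i) /dotp (bigD1 j)//= expr2 lerDl.
by apply: sumr_ge0 => k _; rewrite -expr2 sqr_ge0.
Qed.

Lemma enorm_eq0 u : (enorm u == 0) = (u == 0).
Proof.
apply/eqP/eqP => [u0|->]; last exact: enorm0.
by apply/eqP; rewrite -normr_eq0 eq_le normr_ge0 andbT -[leRHS]u0 norm_le_enorm.
Qed.

Lemma dotp_le_enorm u v : dotp u v <= enorm u * enorm v.
Proof.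
have [->|u0] := eqVneq u 0; first by rewrite dot0p mulr_ge0 ?enorm_ge0.
have [->|v0] := eqVneq v 0.
  by rewrite dotpC dot0p mulr_ge0 ?enorm_ge0.
have a0 : 0 < enorm u by rewrite lt_def enorm_eq0 u0 enorm_ge0.
have b0 : 0 < enorm v by rewrite lt_def enorm_eq0 v0 enorm_ge0.
(* expand the square of the vector |v| u - |u| v *)
have := dotp_ge0 (enorm v *: u + (- enorm u) *: v).
rewrite dotpDl !dotpZl ![dotp _ (_ + _)]dotpC !dotpDl !dotpZl -!sqr_enorm.
rewrite (dotpC v u) => h.
have : 0 <= (enorm u * enorm v) * (enorm u * enorm v - dotp u v) by nra.
by rewrite pmulr_rge0 ?mulr_gt0// subr_ge0.
Qed.

Lemma enormD u v : enorm (u + v) <= enorm u + enorm v.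
Proof.
rewrite -(@ler_pXn2r _ 2) ?nnegrE ?addr_ge0 ?enorm_ge0//.
rewrite sqr_enorm dotpDl ![dotp _ (_ + _)]dotpC !dotpDl (dotpC v u).
rewrite -!sqr_enorm; have := dotp_le_enorm u v; nra.
Qed.

Lemma dotp_continuous (T : topologicalType) (g h : T -> 'rV[R]_n) :
  (forall i, continuous (fun x => g x 0 i)) ->
  (forall i, continuous (fun x => h x 0 i)) ->
  continuous (fun x => dotp (g x) (h x)).
Proof.
move=> gc hc; apply: (@continuous_big R _ +%R 0 xpredT) => [|i _ x].
  by move=> /= z; exact: (@add_continuous R).
by apply: cvgM; [exact: gc|exact: hc].
Qed.

Lemma enorm_comp_continuous (T : topologicalType) (g : T -> 'rV[R]_n) :
  (forall i, continuous (fun x => g x 0 i)) ->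
  continuous (fun x => enorm (g x)).
Proof.
move=> gc x.
apply: (@continuous_comp _ _ _ (fun y => dotp (g y) (g y)) Num.sqrt).
  exact: dotp_continuous.
exact: sqrt_continuous.
Qed.

End Euclidean.

(** * Differentiable convex functions *)

(** A real function that is upper semicontinuous together with its opposite is
    continuous. *)
Lemma usc_opp_continuous (R : realType) (T : topologicalType) (g : T -> R) :
  (forall c, open [set x | g x < c]) -> (forall c, open [set x | - g x < c]) ->
  continuous g.
Proof.
move=> gu gl x; apply/cvgrPdist_lt => e e0.
have h1 : nbhs x [set y | g y < g x + e].
  by apply: open_nbhs_nbhs; split; [exact: gu|rewrite /= ltrDl].
have h2 : nbhs x [set y | - g y < - g x + e].
  by apply: open_nbhs_nbhs; split; [exact: gl|rewrite /= ltrDl].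
apply: filterS (filterI h1 h2) => y /= [y1 y2].
by rewrite ltr_norml; apply/andP; split; lra.
Qed.

Section ConvexGradient.
Context {R : realType} {n : nat} (f : 'rV[R]_n -> R).
Hypothesis f_diff : forall x, differentiable (f : 'rV[R]_n -> R^o) x.
Hypothesis f_convex : convex_function [set: convex_lmodType 'rV[R]_n] f.

Lemma deriv_dotp x v : 'D_v (f : 'rV[R]_n -> R^o) x = dotp v (grad f x).
Proof.
rewrite deriveE//; rewrite {1}(row_sum_delta v) linear_sum.
apply: eq_bigr => i _; rewrite linearZ /= mxE deriveE//.
Qed.

Lemma everywhere_differentiable_continuous : continuous f.
Proof. by move=> x; exact: (differentiable_continuous (f_diff x)). Qed.

Lemma convex_line x v (t : R) : 0 <= t -> t <= 1 ->
  f (x + t *: v) <= f x + t * (f (x + v) - f x).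
Proof.
move=> t0 t1.
have ti : Itv.spec (@Itv.num_sem R) (Itv.Real `[Posz 0, Posz 1]) t.
  by rewrite /= /Itv.num_sem /= num_real /= in_itv /= t0 t1.
have := @f_convex (Itv.mk ti) (x + v) x.
rewrite !inE => /(_ I I).
rewrite /conv /= /unstable.onem.
set y := (X in f X); set z := (X in _ <= X).
have -> : y = x + t *: v.
  rewrite -[y]/(t *: (x + v) + (1 - t) *: x) scalerDr scalerBl scale1r.
  by rewrite addrC addrA addrNK.
have -> : z = f x + t * (f (x + v) - f x).
  by rewrite -[z]/(t * f (x + v) + (1 - t) * f x); ring.
by [].
Qed.

Lemma deriv_cvg_right x v :
  (fun h : R => (f (x + h *: v) - f x) / h) @ 0^'+ -->
  'D_v (f : 'rV[R]_n -> R^o) x.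
Proof.
have /cvg_dnbhs_at_right dv :=
  @diff_derivable _ _ _ (f : _ -> R^o) x v (f_diff x).
rewrite (_ : (fun h : R => _) =
    (fun h : R => h^-1 *: ((f (h *: v + x) : R^o) - f x))).
  exact: dv.
apply/funext => h; rewrite (addrC x).
by rewrite -[RHS]/(h^-1 * (f (h *: v + x) - f x)) mulrC.
Qed.

(** The difference quotients of a convex function are nondecreasing in the
    step, hence bound the directional derivative from above. *)
Lemma deriv_le_quotient x v (t : R) : 0 < t ->
  'D_v (f : 'rV[R]_n -> R^o) x <= (f (x + t *: v) - f x) / t.
Proof.
move=> t0; apply: (cvgr_to_le (deriv_cvg_right x v)); near=> h.
have h0 : 0 < h by near: h; exact: nbhs_right_gt.
have ht : h <= t by near: h; exact: nbhs_right_le.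
have := @convex_line x (t *: v) (h / t) _ _.
rewrite divr_ge0 ?(ltW h0) ?(ltW t0)// ler_pdivrMr// mul1r => /(_ isT ht).
rewrite scalerA divfK ?gt_eqF// => hc.
rewrite ler_pdivrMr// [leRHS](_ : _ = h / t * (f (x + t *: v) - f x)).
  by rewrite lerBlDl.
by ring.
Unshelve. all: by end_near. Qed.

Lemma gradient_inequality x v : f x + dotp v (grad f x) <= f (x + v).
Proof.
have := @deriv_le_quotient x v 1 ltr01.
by rewrite deriv_dotp scale1r divr1; lra.
Qed.

(** As an infimum of continuous difference quotients, a directional derivative
    of a differentiable convex function is upper semicontinuous. *)
Lemma deriv_usc v (c : R) : open [set x | 'D_v (f : 'rV[R]_n -> R^o) x < c].
Proof.
rewrite openE => x /= xc; rewrite /interior.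
have qc : \forall h \near (0 : R)^'+, (f (x + h *: v) - f x) / h < c.
  exact: (cvgr_lt _ (deriv_cvg_right x v)).
have [t [t0 tc]] : exists t : R, 0 < t /\ (f (x + t *: v) - f x) / t < c.
  have [t [t0 tc]] := filter_ex (filterI (nbhs_right_gt (0 : R)) qc).
  by exists t.
have cdiv (S : topologicalType) (g h : S -> R) :
    continuous g -> continuous h -> continuous (fun y => (g y - h y) / t).
  by move=> gc hc y; apply: cvgMr_tmp; apply: cvgB; [exact: gc|exact: hc].
have cadd (V : normedModType R) (a : V) : continuous (fun z => z + a).
  by move=> z; apply: cvgD; [exact: cvg_id|exact: cvg_cst].
have ctn : continuous (fun y => (f (y + t *: v) - f y) / t).
  apply: cdiv; last exact: everywhere_differentiable_continuous.
  move=> y; apply: (@continuous_comp _ _ _ (fun z => z + t *: v) f).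
    exact: cadd.
  exact: everywhere_differentiable_continuous.
have : \forall y \near x, (f (y + t *: v) - f y) / t < c.
  exact: (cvgr_lt _ (ctn x)).
by apply: filterS => y; apply: le_lt_trans; exact: deriv_le_quotient.
Qed.

(** Since the derivative in direction [- v] is the opposite of that in direction
    [v], both are continuous. *)
Lemma grad_continuous i : continuous (fun x => grad f x 0 i).
Proof.
have gE x : grad f x 0 i = 'D_(delta_mx 0 i) (f : 'rV[R]_n -> R^o) x.
  by rewrite mxE.
have gN x : - grad f x 0 i = 'D_(- delta_mx 0 i) (f : 'rV[R]_n -> R^o) x.
  by rewrite gE !deriv_dotp dotpNl.
apply: usc_opp_continuous => c.
  by under eq_set do rewrite gE; exact: deriv_usc.
by under eq_set do rewrite gN; exact: deriv_usc.
Qed.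

End ConvexGradient.

(** * Measurability *)

Section RandomVectors.
Context {d} {T : measurableType d} {R : realType} {n : nat}.
Implicit Types Y Z : T -> 'rV[R]_n.

Lemma random_vector_open Y (U : set 'rV[R]_n) :
  random_vector Y -> open U -> measurable (Y @^-1` U).
Proof. by move=> mY oU; apply: mY; exact: sub_sigma_algebra. Qed.

Lemma random_vector_continuous Y (g : 'rV[R]_n -> R) :
  random_vector Y -> continuous g -> measurable_fun setT (g \o Y).
Proof.
move=> mY /continuousP cg; apply: (measurability _ (RGenOpens.measurableE R)).
move=> _ [_ [a [b ->] <-]]; rewrite setTI comp_preimage.
by apply: random_vector_open => //; apply: cg; exact: interval_open.
Qed.

Lemma random_vector_coord Y i :
  random_vector Y -> measurable_fun setT (fun w => Y w 0 i).
Proof.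
move=> mY; apply: (random_vector_continuous Y (fun u => u 0 i)) => //.
exact: coord_continuous.
Qed.

Lemma dotp_measurable Y Z :
  (forall i, measurable_fun setT (fun w => Y w 0 i)) ->
  (forall i, measurable_fun setT (fun w => Z w 0 i)) ->
  measurable_fun setT (fun w => dotp (Y w) (Z w)).
Proof.
by move=> mY mZ; apply: measurable_sum => i; exact: measurable_funM.
Qed.

Lemma measurable_eq_vector Y Z : random_vector Y -> random_vector Z ->
  measurable [set w | Y w = Z w].
Proof.
move=> mY mZ.
have md : measurable_fun setT (fun w => dotp (Y w - Z w) (Y w - Z w)).
  apply: dotp_measurable => i; under eq_fun do rewrite !mxE;
    by apply: measurable_funB; exact: random_vector_coord.
have -> : [set w | Y w = Z w] =
    (fun w => dotp (Y w - Z w) (Y w - Z w) == 0) @^-1` [set true].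
  apply/seteqP; split => w /=; first by move=> ->; rewrite subrr dot0p eqxx.
  move=> /eqP h; apply/eqP; rewrite -subr_eq0 -enorm_eq0 -sqrf_eq0.
  by rewrite sqr_enorm h.
rewrite -[X in measurable X]setTI.
have := measurable_fun_eqr md (measurable_cst (0 : R)).
by move=> /(_ measurableT [set true]); apply.
Qed.

End RandomVectors.

(** * Exponents and geometric decay *)

Section Exponent.
Context {R : realType} (theta gamma p : R).
Hypotheses (theta_gt0 : 0 < theta) (theta_lt1 : theta < 1).
Hypotheses (gamma_ge1 : 1 <= gamma) (p_ge0 : 0 <= p) (p_le1 : p <= 1).
Hypothesis p_gt : ln gamma / ln (theta^-1 * gamma) < p.

Lemma ascent_prob_gt0 : 0 < p.
Proof.
apply: le_lt_trans p_gt; rewrite divr_ge0 ?ln_ge0//.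
rewrite (le_trans gamma_ge1)// ler_peMl ?(le_trans ler01)//.
by rewrite invf_ge1// ltW.
Qed.

(** When failures have probability [p], the condition on [p] says that the
    expected logarithm of the step-size factor is negative, so some small power
    of the factor has expectation below one. *)
Lemma contracting_exponent :
  exists2 s : R, 0 < s & (1 - p) * gamma `^ s + p * theta `^ s < 1.
Proof.
have gamma_gt0 : 0 < gamma by exact: lt_le_trans gamma_ge1.
set a := ln gamma; set b := - ln theta.
have a0 : 0 <= a by exact: ln_ge0.
have b0 : 0 < b by rewrite oppr_gt0; apply: ln_lt0; rewrite theta_gt0.
have a1 : 0 < 1 + a by rewrite ltr_pwDl.
have ab1 : 0 < 1 + a * b by rewrite ltr_pwDl// mulr_ge0// ltW.
have drift : 0 < p * (a + b) - a.
  rewrite subr_gt0 -ltr_pdivrMr ?ltr_wpDl//.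
  by move: p_gt; rewrite lnM ?posrE ?invr_gt0// lnV ?posrE// addrC.
(* s is small enough for 1 / (1 - s a) and 1 / (1 + s b), which bound the powers
   of gamma and theta because exp x is at least 1 + x, to average below 1 *)
pose s := Num.min (2^-1 / (1 + a)) ((p * (a + b) - a) / 2 / (1 + a * b)).
have s0 : 0 < s by rewrite lt_min !divr_gt0.
have sa : s * a < 1.
  have : s * (1 + a) <= 2^-1 by rewrite -ler_pdivlMr// ge_min lexx.
  lra.
have sab : s * (1 + a * b) <= (p * (a + b) - a) / 2.
  by rewrite -ler_pdivlMr// ge_min lexx orbT.
exists s => //.
have g1 : gamma `^ s <= (1 - s * a)^-1.
  rewrite /powR gt_eqF// -[expR _]invrK -expRN.
  rewrite lef_pV2 ?posrE ?expR_gt0 ?subr_gt0//.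
  exact: expR_ge1Dx.
have t1 : theta `^ s <= (1 + s * b)^-1.
  rewrite /powR gt_eqF// -[expR _]invrK -expRN lef_pV2 ?posrE ?expR_gt0//.
    by rewrite -mulrN; exact: expR_ge1Dx.
  by rewrite ltr_pwDl// mulr_ge0// ltW.
have h : (1 - p) * (1 - s * a)^-1 + p * (1 + s * b)^-1 < 1.
  have sb : 0 < 1 + s * b by rewrite ltr_pwDl// mulr_ge0// ltW.
  have sa' : 0 < 1 - s * a by rewrite subr_gt0.
  rewrite -subr_gt0 (_ : 1 - _ = s * (p * (a + b) - a - s * (a * b)) /
      ((1 - s * a) * (1 + s * b))); last by field; rewrite !gt_eqF.
  rewrite divr_gt0 ?mulr_gt0//.
  have := s0; nra.
by apply: le_lt_trans h; rewrite lerD// ler_wpM2l// subr_ge0.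
Qed.

End Exponent.

Lemma powR1x {R : realType} (s : R) : 1 `^ s = 1.
Proof. by rewrite powR1. Qed.

Lemma powRX {R : realType} (x s : R) k :
  0 <= x -> (x ^+ k) `^ s = (x `^ s) ^+ k.
Proof.
move=> x0; elim: k => [|k IHk]; first by rewrite !expr0 powR1.
by rewrite !exprS powRM ?exprn_ge0// IHk.
Qed.

Lemma geometric_small {R : realType} (t M e : R) : 0 <= t -> t < 1 -> 0 < e ->
  exists k, t ^+ k * M <= e.
Proof.
move=> t0 t1 e0.
have : geometric M t @ \oo --> (0 : R).
  by apply: cvg_geometric; rewrite ger0_norm.
move=> /cvgrPdist_le /(_ e e0) [k _ /(_ k (leqnn k))] /=.
rewrite sub0r normrN => h; exists k.
by rewrite mulrC (le_trans _ h)// ler_norm.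
Qed.

Lemma geometric_sum_le {R : realType} (c r : R) k : 0 <= c -> 0 <= r -> r < 1 ->
  \sum_(i < k) c * r ^+ i <= c / (1 - r).
Proof.
move=> c0 r0 r1; rewrite -mulr_sumr ler_wpM2l//.
have r1' : 0 < 1 - r by rewrite subr_gt0.
rewrite -[leRHS]div1r ler_pdivlMr//.
have := subrX1 r k; have := exprn_ge0 k r0; lra.
Qed.

(** * Probabilistic direct search *)

Section DirectSearch.
Context {d : measure_display} {T : measurableType d} {R : realType} {n : nat}.
Context (P : probability T R) (f : 'rV[R]_n -> R).
Hypothesis f_diff : forall x, differentiable (f : 'rV[R]_n -> R^o) x.
Hypothesis f_convex : convex_function [set: convex_lmodType 'rV[R]_n] f.
Context (x0 : 'rV[R]_n) (alpha0 theta gamma : R).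
Hypothesis alpha0_gt0 : 0 < alpha0.
Hypotheses (theta_gt0 : 0 < theta) (theta_lt1 : theta < 1).
Hypothesis gamma_ge1 : 1 <= gamma.
Context (rho : R -> R).
Hypothesis rho_gt0 : forall a, 0 < a -> 0 < rho a.
Context (c0 : R).
Context (D : nat -> T -> seq 'rV[R]_n) (X : nat -> T -> 'rV[R]_n).
Context (A : nat -> T -> R).
Hypothesis pds : PDS f x0 alpha0 theta gamma rho D X A.
Context (p : R).
Hypotheses (p_ge0 : 0 <= p) (p_le1 : p <= 1).
Hypothesis ascent : probabilistic_ascent P f c0 D X p.
Hypothesis p_gt : ln gamma / ln (theta^-1 * gamma) < p.

Let gamma_gt0 : 0 < gamma. Proof. exact: lt_le_trans gamma_ge1. Qed.

(** ** Sample paths *)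

(** The event that iteration [k] is unsuccessful; it is phrased through the
    iterates only, so that it belongs to the history of the process. *)
Definition failure k : set T := [set w | X k.+1 w = X k w].

Lemma step_size_gt0 k w : 0 < A k w.
Proof.
elim: k => [|k IHk]; first by rewrite (pds_A0 pds).
have [s|s] := pselect (exists2 v, v \in D k w &
    sufficient_decrease f rho (X k w) (A k w) v).
  by have [_ ->] := pds_success pds s; rewrite mulr_gt0.
by have [_ ->] := pds_failure pds s; rewrite mulr_gt0.
Qed.

Lemma failureP k w : failure k w <->
  ~ (exists2 v, v \in D k w & sufficient_decrease f rho (X k w) (A k w) v).
Proof.
split=> [fk s|s]; last by have [] := pds_failure pds s.
have [[v [vD _ Xv]] _] := pds_success pds s.
move: fk; rewrite /failure /= Xv => /eqP; rewrite -subr_eq0 addrAC subrr add0r.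
rewrite scaler_eq0 gt_eqF ?step_size_gt0//= -enorm_eq0.
by rewrite (pds_D_unit pds vD) oner_eq0.
Qed.

Lemma failure_step_size k w : failure k w -> A k.+1 w = theta * A k w.
Proof. by move=> /failureP/(pds_failure pds)[]. Qed.

Lemma success_step_size k w : ~ failure k w -> A k.+1 w = gamma * A k w.
Proof. by move/failureP/contrapT/(pds_success pds) => []. Qed.

Lemma iterate_step k w : `|X k.+1 w - X k w| <= A k w.
Proof.
have [fk|/failureP/contrapT s] := pselect (failure k w).
  by rewrite fk subrr normr0 ltW// step_size_gt0.
have [[v [vD _ ->]] _] := pds_success pds s.
rewrite addrAC subrr add0r normrZ gtr0_norm ?step_size_gt0//.
rewrite ler_piMr ?(ltW (step_size_gt0 _ _))//.
by rewrite -(pds_D_unit pds vD) norm_le_enorm.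
Qed.

(** By convexity, [f] does not decrease along a direction whose inner product
    with the gradient is nonnegative. *)
Lemma ascent_failure k w :
  (forall v, v \in D k w -> 0 <= dotp v (grad f (X k w))) -> failure k w.
Proof.
move=> asc; apply/failureP => -[v vD]; rewrite /sufficient_decrease => dec.
have := gradient_inequality f f_diff f_convex (X k w) (A k w *: v).
rewrite dotpZl => h.
have := mulr_ge0 (ltW (step_size_gt0 k w)) (asc v vD).
have := rho_gt0 (A k w) (step_size_gt0 k w).
lra.
Qed.

Lemma stationary_failure k w : grad f (X k w) = 0 -> failure k w.
Proof. by move=> g0; apply: ascent_failure => v _; rewrite g0 dotpC dot0p. Qed.

(** The quantifier runs over all indices: past the end of the list, [nth]
    returns the zero vector, which satisfies the inequality. *)
Lemma cm_le0P k w : grad f (X k w) <> 0 ->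
  cm c0 (D k w) (- grad f (X k w)) <= 0 <->
  forall i, 0 <= dotp (nth 0 (D k w) i) (grad f (X k w)).
Proof.
move=> /eqP g0; rewrite /cm oppr_eq0 (negbTE g0).
have posg v : v \in D k w -> 0 < enorm v * enorm (- grad f (X k w)).
  move=> vD; rewrite (pds_D_unit pds vD) mul1r lt_def enorm_ge0 andbT.
  by rewrite enorm_eq0 oppr_eq0.
have termE v : v \in D k w ->
    (dotp v (- grad f (X k w)) / (enorm v * enorm (- grad f (X k w))) <= 0) =
    (0 <= dotp v (grad f (X k w))).
  move=> vD; rewrite ler_pdivrMr ?posg// mul0r dotpC dotpNl dotpC.
  by rewrite oppr_le0.
split=> [cm0 i|h].
  have [iD|Di] := ltnP i (size (D k w)); last by rewrite nth_default// dot0p.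
  rewrite -termE ?mem_nth//; apply: le_trans cm0.
  exact: (@le_bigmax_seq _ _ _ _ _ _ xpredT (fun v =>
    dotp v (- grad f (X k w)) / (enorm v * enorm (- grad f (X k w))))
    (mem_nth 0 iD)).
rewrite big_seq; apply: bigmax_le => [|v vD]; first by rewrite lerN10.
by rewrite termE// -(nth_index 0 vD).
Qed.

(** ** Histories *)

(** The generating events of [history D X k]. *)
Let gen k := \bigcup_(j in [set j | (j < k)%N])
  (sigma_seq (D j) `|` sigma_vec (X j.+1)).

(** [Tk k] is the sample space equipped with the sigma-algebra [history D X k],
    which gives access to the theory of measurable functions for it. *)
Let Tk k := g_sigma_algebraType (gen k).

Lemma historyE k B : history D X k B = measurable (B : set (Tk k)).
Proof. by []. Qed.

Lemma history_le j k : (j <= k)%N -> history D X j `<=` history D X k.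
Proof.
move=> jk; apply: sub_sigma_algebra2 => B [i ij iB].
by exists i => //; exact: leq_trans jk.
Qed.

Lemma history_measurable k B : history D X k B -> measurable B.
Proof.
move: B; apply: smallest_sub; first exact: sigma_algebra_measurable.
move=> B [j _ [[i _ [C bC <-]]|[C bC <-]]]; rewrite setTI.
  exact: pds_D_random pds _ _ _ bC.
exact: pds_X_random pds _ _ bC.
Qed.

Lemma historyI k B C :
  history D X k B -> history D X k C -> history D X k (B `&` C).
Proof. by rewrite !historyE; exact: measurableI. Qed.

Lemma historyC k B : history D X k B -> history D X k (~` B).
Proof. by rewrite !historyE; exact: measurableC. Qed.

Lemma iterate_adapted k : @random_vector _ (Tk k) R n (X k).
Proof.
case: k => [|k] B bB.
  rewrite (_ : X 0%N = cst x0) ?preimage_cst; first by case: ifPn.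
  by apply/funext => w; rewrite (pds_X0 pds).
apply: sub_sigma_algebra; exists k => //=; right; exists B => //.
by rewrite setTI.
Qed.

Lemma failure_history k : history D X k.+1 (failure k).
Proof.
rewrite historyE; apply: (@measurable_eq_vector _ (Tk k.+1) R n (X k.+1) (X k)).
  exact: iterate_adapted.
move=> B bB; apply: (history_le k) => //; exact: iterate_adapted.
Qed.

Lemma stationary_history k : history D X k [set w | grad f (X k w) = 0].
Proof.
have mg : measurable_fun setT ((fun x => enorm (grad f x)) \o X k : Tk k -> R).
  apply: random_vector_continuous; first exact: iterate_adapted.
  by apply: enorm_comp_continuous => i; exact: grad_continuous.
rewrite historyE (_ : mkset _ =
    ((fun x => enorm (grad f x)) \o X k) @^-1` [set 0]).
  by rewrite -[X in measurable X]setTI; apply: mg.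
apply/seteqP; split => w /=; first by move=> ->; rewrite enorm0.
by move=> /eqP; rewrite enorm_eq0 => /eqP.
Qed.

(** ** Probability of failure *)

(** Probabilities of events as real numbers. *)
Let pr (B : set T) : R := fine (P B).

Let prE B : measurable B -> P B = (pr B)%:E.
Proof. by move=> mB; rewrite fineK// fin_num_measure. Qed.

Let pr_ge0 B : 0 <= pr B.
Proof. by rewrite fine_ge0. Qed.

Let pr_le B C : measurable B -> measurable C -> B `<=` C -> pr B <= pr C.
Proof.
by move=> mB mC BC; rewrite -lee_fin -!prE// le_measure// inE.
Qed.

Let pr_split B C : measurable B -> measurable C ->
  pr B = pr (B `&` C) + pr (B `&` ~` C).
Proof.
move=> mB mC.
have mBC := measurableI _ _ mB mC.
have mBnC := measurableI _ _ mB (measurableC mC).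
have : (P B = P (B `\` C) + P (B `&` C))%E by exact: measureDI.
rewrite setDE !prE// -EFinD => -[->].
by rewrite addrC.
Qed.

(** An iteration started at a nonstationary point fails at least when all the
    polling directions are ascent directions, and one started at a stationary
    point always does. *)
Lemma failure_ge k B : history D X k B -> p * pr B <= pr (B `&` failure k).
Proof.
move=> hB; have mB := history_measurable _ _ hB.
have mF := history_measurable _ _ (failure_history k).
set S := [set w | grad f (X k w) = 0].
have hS : history D X k S by exact: stationary_history.
have mS := history_measurable _ _ hS.
set E := [set w | cm c0 (D k w) (- grad f (X k w)) <= 0].
set B' := B `&` ~` S.
have hB' : history D X k B' by apply: historyI => //; exact: historyC.
have mB' := history_measurable _ _ hB'.
have mEB' : measurable (E `&` B').
  have -> : E `&` B' = (\bigcap_i [set w |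
      0 <= dotp (nth 0 (D k w) i) (grad f (X k w))]) `&` B'.
    apply/seteqP; split => w [Ew [Bw Sw]]; split => //.
      by move=> i _; exact: ((cm_le0P _ _ Sw).1 Ew).
    by apply/(cm_le0P _ _ Sw) => i; exact: Ew.
  apply: measurableI => //; apply: bigcapT_measurable => i.
  have md : measurable_fun setT
      (fun w => dotp (nth 0 (D k w) i) (grad f (X k w))).
    apply: dotp_measurable => j.
      apply: (random_vector_coord (fun w => nth 0 (D k w) i)).
      exact: pds_D_random pds _ _.
    apply: (random_vector_continuous (X k) (fun x => grad f x 0 j)).
      exact: pds_X_random pds _.
    exact: grad_continuous.
  have := measurable_fun_ler (measurable_cst (0 : R)) md.
  move=> /(_ measurableT [set true] I); rewrite setTI; congr measurable.
have [Z [mZ iZ intZ] Zp] := ascent k.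
have mZT : measurable_fun setT Z.
  by move=> _ C mC; rewrite setTI; apply: history_measurable; exact: mZ.
have EB' : p * pr B' <= pr (E `&` B').
  rewrite -lee_fin -[leRHS]prE// -intZ// EFinM -prE//.
  (* Z is at least p almost surely on B', so truncating it below at p, which
     makes it nonnegative everywhere, does not change its integral *)
  have -> : (\int[P]_(w in B') (Z w)%:E =
      \int[P]_(w in B') (Num.max (Z w) p)%:E)%E.
    apply: ae_eq_integral => //.
    - by apply/measurable_EFinP; exact: measurable_funS mZT.
    - apply/measurable_EFinP; apply: (measurable_funS measurableT) => //.
      by apply: measurable_maxr => //; exact: measurable_cst.
    - apply: filterS Zp => w + [Bw Sw].
      by rewrite indicE mem_set// mulr1 => /max_idPl ->.
  rewrite -integral_cst//; apply: ge0_le_integral => //.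
  - apply/measurable_EFinP; apply: (measurable_funS measurableT) => //.
    by apply: measurable_maxr => //; exact: measurable_cst.
  - by move=> w _; rewrite lee_fin le_max lexx orbT.
rewrite (pr_split _ _ mB mS) (pr_split _ _ (measurableI _ _ mB mF) mS) mulrDr.
rewrite lerD//.
  have -> : B `&` failure k `&` S = B `&` S.
    apply/seteqP; split => w; first by move=> [[]].
    by move=> [Bw Sw]; split => //; split => //; exact: stationary_failure.
  by rewrite ler_piMl.
apply: (le_trans EB'); apply: pr_le => //.
  by apply: measurableI; [exact: measurableI|exact: measurableC].
move=> w [Ew [Bw Sw]]; split => //; split => //.
apply: ascent_failure => v vD; rewrite -(nth_index 0 vD).
exact: ((cm_le0P _ _ Sw).1 Ew).
Qed.

(** ** Decay of the step sizes *)

Let step_size_gt_measurable k c : measurable [set w | c < A k w].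
Proof.
have := pds_A_random pds k.
move=> /(_ measurableT `]c, +oo[%classic (measurable_itv _)); rewrite setTI.
by congr measurable; apply/seteqP; split => w /=; rewrite in_itv/= andbT.
Qed.

(** The bound that Markov's inequality gives for the supermartingale obtained
    from the step sizes raised to the power [s], conditionally on an event [B]
    of the history on which the current step size is a constant [a]. Since an
    iteration changes the step size in one of two ways only, induction on [j]
    suffices. *)
Lemma step_size_tail s c : 0 < s -> 0 < c -> forall j k a B, 0 < a ->
  history D X k B -> (forall w, B w -> A k w = a) ->
  pr (B `&` [set w | c < A (k + j)%N w]) <=
    ((1 - p) * gamma `^ s + p * theta `^ s) ^+ j * (a / c) `^ s * pr B.
Proof.
move=> s0 c_gt0; elim=> [|j IHj] k a B a0 hB BA;
  have mB := history_measurable _ _ hB.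
  rewrite addn0 expr0 mul1r; have [ca|ac] := ltP c a.
    apply: (@le_trans _ _ (pr B)).
      by apply: pr_le => //; exact: measurableI.
    rewrite ler_peMl// -(powR1x s) ge0_ler_powR ?nnegrE// ?(ltW s0)//.
      by rewrite divr_ge0// ltW.
    by rewrite ler_pdivlMr// mul1r ltW.
  have -> : B `&` [set w | c < A k w] = set0.
    by apply/seteqP; split => w //= -[Bw]; rewrite BA// ltNge ac.
  by rewrite {1}/pr measure0 mulr_ge0 ?powR_ge0.
have hF := failure_history k; have mF := history_measurable _ _ hF.
have hB1 : history D X k.+1 B by exact: (history_le _ _ (leqnSn k) _ hB).
set U := [set w | _]; have mU : measurable U by exact: step_size_gt_measurable.
have onF : pr (B `&` failure k `&` U) <=
    ((1 - p) * gamma `^ s + p * theta `^ s) ^+ j * (theta * a / c) `^ s *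
    pr (B `&` failure k).
  rewrite /U -addSnnS; apply: IHj; first by rewrite mulr_gt0.
    exact: historyI.
  by move=> w [Bw Fw]; rewrite failure_step_size// BA.
have onS : pr (B `&` ~` failure k `&` U) <=
    ((1 - p) * gamma `^ s + p * theta `^ s) ^+ j * (gamma * a / c) `^ s *
    pr (B `&` ~` failure k).
  rewrite /U -addSnnS; apply: IHj; first by rewrite mulr_gt0.
    by apply: historyI => //; exact: historyC.
  by move=> w [Bw Fw]; rewrite success_step_size// BA.
rewrite (pr_split _ _ (measurableI _ _ mB mU) mF) ![B `&` U `&` _]setIAC.
apply: (le_trans (lerD onF onS)).
have ac0 : 0 <= a / c by rewrite divr_ge0// ltW.
have factorE x : 0 < x -> (x * a / c) `^ s = x `^ s * (a / c) `^ s.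
  by move=> x_gt0; rewrite -mulrA powRM// ltW.
rewrite !factorE//.
have := failure_ge _ _ hB; rewrite {}[in X in _ -> X](pr_split _ _ mB mF).
rewrite (pr_split _ _ mB mF); set pf := pr (_ `&` failure k).
set ps := pr _; set qj := _ ^+ j => fge.
have qj0 : 0 <= qj.
  by rewrite exprn_ge0// addr_ge0// mulr_ge0 ?powR_ge0// subr_ge0.
have tg : theta `^ s <= gamma `^ s.
  rewrite ge0_ler_powR ?nnegrE ?(ltW s0) ?(ltW theta_gt0) ?(ltW gamma_gt0)//.
  exact: le_trans (ltW theta_lt1) gamma_ge1.
rewrite exprSr -/qj.
(* the left-hand side is largest when failures are as rare as possible, because
   theta <= gamma *)
have key : theta `^ s * pf + gamma `^ s * ps <=
    ((1 - p) * gamma `^ s + p * theta `^ s) * (pf + ps).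
  have : 0 <= (gamma `^ s - theta `^ s) * (pf - p * (pf + ps)).
    by rewrite mulr_ge0// subr_ge0.
  lra.
have := ler_wpM2l (mulr_ge0 qj0 (powR_ge0 (a / c) s)) key.
rewrite mulrDr => h; apply: le_trans (le_trans h _).
  by rewrite le_eqVlt; apply/orP; left; apply/eqP; ring.
by rewrite le_eqVlt; apply/orP; left; apply/eqP; ring.
Qed.

(** ** Staying close to the starting point *)

(** The event that the first [K] iterations are unsuccessful. *)
Fixpoint initial_failures K : set T :=
  if K is K'.+1 then initial_failures K' `&` failure K' else setT.

Lemma initial_failures_history K : history D X K (initial_failures K).
Proof.
elim: K => [|K IHK /=]; first by rewrite historyE; exact: measurableT.
apply: historyI; last exact: failure_history.
exact: (history_le _ _ (leqnSn K) _ IHK).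
Qed.

Lemma initial_failures_ge K : p ^+ K <= pr (initial_failures K).
Proof.
elim: K => [|K IHK /=]; first by rewrite /pr probability_setT.
rewrite exprS (le_trans (ler_wpM2l p_ge0 IHK))//.
exact: failure_ge (initial_failures_history K).
Qed.

Lemma initial_failures_step_size K w :
  initial_failures K w -> A K w = theta ^+ K * alpha0.
Proof.
elim: K => [_|K IHK [/IHK AK FK]]; first by rewrite (pds_A0 pds) expr0 mul1r.
by rewrite failure_step_size// AK exprS mulrA.
Qed.

Lemma initial_failures_iterate K j w :
  initial_failures K w -> (j <= K)%N -> X j w = x0.
Proof.
elim: K j => [|K IHK] j.
  by rewrite leqn0 => _ /eqP ->; exact: pds_X0 pds _.
move=> [IK FK]; rewrite leq_eqVlt ltnS => /predU1P[->|]; last exact: IHK.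
by rewrite FK IHK.
Qed.

(** With positive probability, all the iterates stay in a prescribed ball around
    the starting point. *)
Lemma stay_close (delta : R) : 0 < delta ->
  exists V, [/\ measurable V, (0 < P V)%E &
    forall w k, V w -> `|X k w - x0| <= delta].
Proof.
move=> delta0.
have p0 : 0 < p :=
  ascent_prob_gt0 theta gamma p theta_gt0 theta_lt1 gamma_ge1 p_gt.
have [s s0] := contracting_exponent theta gamma p theta_gt0 theta_lt1 gamma_ge1
  p_ge0 p_le1 p_gt.
set q := _ + _ => q1.
have q0 : 0 <= q by rewrite addr_ge0// mulr_ge0 ?powR_ge0// subr_ge0.
(* the step size of iteration K + j is compared with c r^j, whose sum over j is
   delta; since q < r^s = (1 + q) / 2, the tail bounds form a geometric series
   of ratio t = q / r^s < 1 *)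
pose r := ((1 + q) / 2) `^ s^-1.
have u0 : 0 < (1 + q) / 2 by lra.
have u1 : (1 + q) / 2 < 1 by lra.
have rs : r `^ s = (1 + q) / 2.
  by rewrite /r -powRrM mulVf ?gt_eqF// powRr1// ltW.
have r0 : 0 < r by rewrite powR_gt0.
have r1 : r < 1.
  by rewrite -(powR1x s^-1) gt0_ltr_powR ?invr_gt0 ?nnegrE ?(ltW u0).
pose c := delta * (1 - r).
have cp : 0 < c by rewrite mulr_gt0// subr_gt0.
pose t := q / r `^ s.
have t0 : 0 <= t by rewrite divr_ge0 ?powR_ge0.
have t1 : t < 1 by rewrite /t rs ltr_pdivrMr// mul1r; lra.
have [K KM] : exists K,
    (theta `^ s) ^+ K * ((alpha0 / c) `^ s / (1 - t)) <= 2^-1.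
  apply: geometric_small; rewrite ?powR_ge0// -(powR1x s).
  by rewrite gt0_ltr_powR ?nnegrE ?ltW.
pose B := initial_failures K.
have hB : history D X K B := initial_failures_history K.
have mB := history_measurable _ _ hB.
have Bp : 0 < pr B.
  by apply: lt_le_trans (initial_failures_ge K); rewrite exprn_gt0.
pose a := theta ^+ K * alpha0.
have a0 : 0 < a by rewrite mulr_gt0 ?exprn_gt0.
pose U j := B `&` [set w | c * r ^+ j < A (K + j)%N w].
have mU j : measurable (U j) by apply: measurableI.
have Uj j : pr (U j) <= (a / c) `^ s * pr B * t ^+ j.
  have := step_size_tail s (c * r ^+ j) s0 _ j K a B a0 hB
    (initial_failures_step_size K).
  rewrite mulr_gt0 ?exprn_gt0// => /(_ isT) h; apply: (le_trans h).
  have rV : r^-1 `^ s = (r `^ s)^-1.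
    by rewrite -(powR_inv1 (ltW r0)) -powRrM mulN1r powRN.
  have -> : a / (c * r ^+ j) = a / c * r^-1 ^+ j by rewrite exprVn invfM mulrA.
  rewrite powRM ?exprn_ge0 ?invr_ge0 ?divr_ge0 ?(ltW a0) ?(ltW cp) ?(ltW r0)//.
  rewrite powRX ?invr_ge0 ?(ltW r0)// rV /t exprMn le_eqVlt -/q.
  by apply/orP; left; apply/eqP; ring.
have PU : (P (\bigcup_j U j) <= (pr B / 2)%:E)%E.
  apply: (@le_trans _ _ (\sum_(0 <= j <oo) P (U j))%E).
    by apply: measure_sigma_subadditive => //; exact: bigcupT_measurable.
  apply: lime_le; first exact: is_cvg_nneseries.
  apply: nearW => m; rewrite (eq_bigr (fun j => (pr (U j))%:E)); last first.
    by move=> j _; exact: prE.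
  rewrite sumEFin lee_fin big_mkord.
  apply: (@le_trans _ _ (\sum_(j < m) (a / c) `^ s * pr B * t ^+ j)).
    by apply: ler_sum => j _; exact: Uj.
  apply: (le_trans (geometric_sum_le _ _ m _ t0 t1)).
    by rewrite mulr_ge0 ?powR_ge0.
  have -> : (a / c) `^ s * pr B / (1 - t) =
      pr B * ((theta `^ s) ^+ K * ((alpha0 / c) `^ s / (1 - t))).
    have -> : (a / c) `^ s = (theta `^ s) ^+ K * (alpha0 / c) `^ s.
      rewrite /a -mulrA powRM ?exprn_ge0 ?divr_ge0 ?ltW//.
      by rewrite powRX ?(ltW theta_gt0).
    ring.
  by rewrite ler_wpM2l.
pose V := B `\` \bigcup_j U j.
have mV : measurable V by apply: measurableD => //; exact: bigcupT_measurable.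
exists V; split => //.
- have PB : (P B <= P V + P (\bigcup_j U j))%E.
    apply: (@le_trans _ _ (P (V `|` \bigcup_j U j))).
      rewrite le_measure// ?inE//.
        by apply: measurableU => //; exact: bigcupT_measurable.
      move=> w Bw.
      by have [Uw|nUw] := pselect ((\bigcup_j U j) w); [right|left].
    by apply: measureU2 => //; exact: bigcupT_measurable.
  rewrite ltNge; apply/negP => V0.
  have := le_trans PB (leeD V0 PU); rewrite add0e prE// lee_fin.
  by move: Bp; lra.
- move=> w k [Bw nU].
  have Ac j : A (K + j)%N w <= c * r ^+ j.
    by rewrite leNgt; apply/negP => h; apply: nU; exists j.
  have [kK|/ltnW/subnKC <-] := leqP k K.
    by rewrite (initial_failures_iterate K)// subrr normr0 ltW.
  have : `|X (K + (k - K))%N w - x0| <= \sum_(i < k - K) c * r ^+ i.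
    elim: (k - K)%N => [|j IHj].
      by rewrite addn0 big_ord0 (initial_failures_iterate K)// subrr normr0.
    rewrite big_ord_recr/= addnS -(subrK (X (K + j)%N w) (X (K + j).+1 w)).
    rewrite -addrA addrC (le_trans (ler_normD _ _))// lerD//.
    exact: le_trans (iterate_step _ _) (Ac j).
  move=> /le_trans; apply.
  apply: le_trans (geometric_sum_le _ _ _ _ (ltW r0) r1) _.
    exact: ltW.
  by rewrite /c mulfK// subr_eq0 gt_eqF.
Qed.

End DirectSearch.

(** * Lower semicontinuous functions along the iterates *)

Lemma inf_gt0P {R : realType} (u : nat -> \bar R) :
  (0 < ereal_inf [set u k | k in [set: nat]])%E <->
  exists m : nat, forall k, (m.+1%:R^-1%:E < u k)%E.
Proof.
split=> [|[m um]]; last first.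
  apply: (@lt_le_trans _ _ m.+1%:R^-1%:E); first by rewrite lte_fin.
  by apply/ereal_infP => _ [k _ <-]; exact/ltW.
set i := ereal_inf _ => i0.
have [m mi] : exists m : nat, (m.+1%:R^-1%:E < i)%E.
  move: i0; case: i => [r| |]; rewrite ?lte_fin//.
    2: by exists 0%N; rewrite ltry.
  by move=> /ltr_add_invr[m]; rewrite add0r => mr; exists m; rewrite lte_fin.
by exists m => k; apply: (lt_le_trans mi); apply: ereal_inf_lbound; exists k.
Qed.

Lemma measurable_inf_gt0 {d} {T : measurableType d} {R : realType} {n : nat}
    (X : nat -> T -> 'rV[R]_n) (mu : 'rV[R]_n -> \bar R) :
  (forall k, random_vector (X k)) -> lower_semicontinuous mu ->
  measurable [set w | (0 < ereal_inf [set mu (X k w) | k in [set: nat]])%E].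
Proof.
move=> mX /lower_semicontinuousP lmu.
rewrite (_ : mkset _ = \bigcup_m \bigcap_k
    (X k @^-1` [set x | (m.+1%:R^-1%:E < mu x)%E])).
  apply: bigcupT_measurable => m; apply: bigcapT_measurable => k.
  by apply: (random_vector_open (X k)); [exact: mX|exact: lmu].
apply/seteqP; split => w /=; rewrite inf_gt0P.
  by move=> [m um]; exists m => // k _; exact: um.
by move=> [m _ um]; exists m => k; exact: um.
Qed.

Section Semicontinuity.
Context {R : realType} {n : nat} (f : 'rV[R]_n -> R).
Hypothesis f_diff : forall x, differentiable (f : 'rV[R]_n -> R^o) x.
Hypothesis f_convex : convex_function [set: convex_lmodType 'rV[R]_n] f.

Lemma continuous_lsc (g : 'rV[R]_n -> R) :
  continuous g -> lower_semicontinuous (EFin \o g).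
Proof.
move=> /continuousP cg; apply/lower_semicontinuousP => a.
rewrite (_ : mkset _ = g @^-1` [set y | a < y]).
  by apply: cg; exact: open_gt.
by apply/seteqP; split => x /=; rewrite lte_fin.
Qed.

Lemma inff_le (x : 'rV[R]_n) : (inff f <= (f x)%:E)%E.
Proof. by apply: ereal_inf_lbound; exists x. Qed.

Lemma inff_lt_pinfty (x : 'rV[R]_n) : (inff f < +oo)%E.
Proof. by rewrite (le_lt_trans (inff_le x))// ltry. Qed.

Lemma lsc_subinff :
  lower_semicontinuous (fun x : 'rV[R]_n => (f x)%:E - inff f)%E.
Proof.
have /continuousP cf := everywhere_differentiable_continuous f f_diff.
apply/lower_semicontinuousP => a; have := inff_lt_pinfty 0.
case: (inff f) => [m _|//|_].
  rewrite (_ : mkset _ = f @^-1` [set y | a + m < y]).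
    by apply: cf; exact: open_gt.
  by apply/seteqP; split => x /=; rewrite -EFinB lte_fin ltrBrDr.
rewrite (_ : mkset _ = setT); first exact: openT.
by apply/seteqP; split => x //= _; rewrite ltry.
Qed.

Lemma minimizer_stationary x : (forall y, f x <= f y) -> grad f x = 0.
Proof.
move=> xmin.
have D0 : 0 <= 'D_(- grad f x) (f : 'rV[R]_n -> R^o) x.
  apply: (cvgr_to_ge (deriv_cvg_right f f_diff x (- grad f x))); near=> h.
  apply: divr_ge0; first by rewrite subr_ge0; exact: xmin.
  by apply: ltW; near: h; exact: nbhs_right_gt.
move: D0; rewrite (deriv_dotp f f_diff) dotpNl oppr_ge0 => g0.
apply/eqP; rewrite -enorm_eq0 -sqrf_eq0 sqr_enorm.
by rewrite eq_le g0 dotp_ge0.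
Unshelve. all: by end_near. Qed.

Lemma nonstationary_inff x : grad f x != 0 -> (inff f < (f x)%:E)%E.
Proof.
move=> gx; rewrite lt_neqAle inff_le andbT; apply: contra gx => /eqP fx.
apply/eqP/minimizer_stationary => y; rewrite -lee_fin -fx; exact: inff_le.
Qed.

Lemma lsc_gap (S : set 'rV[R]_n) :
  lower_semicontinuous (fun x : 'rV[R]_n => gap [set x] S).
Proof.
move=> x a ax.
have [a' aa' xa'] : exists2 a', a < a' & (a'%:E <= gap [set x] S)%E.
  move: ax; case: (gap _ _) => [r| |//].
    by rewrite lte_fin => ar; exists r.
  by move=> _; exists (a + 1); rewrite ?ltrDl// leey.
have cadd (U : topologicalType) (h : U -> R) (c : R) :
    continuous h -> continuous (fun y => c - h y).
  by move=> hc y; apply: cvgB; [exact: cvg_cst|exact: hc].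
have ce : continuous (fun y : 'rV[R]_n => enorm ((x : 'rV[R]_n) - y)).
  apply: enorm_comp_continuous => i; under eq_fun do rewrite !mxE.
  by apply: cadd; exact: coord_continuous.
exists [set y : 'rV[R]_n | enorm ((x : 'rV[R]_n) - y) < (a' - a) / 2].
  apply: open_nbhs_nbhs; split; last first.
    by rewrite /= subrr enorm0 divr_gt0 ?subr_gt0.
  by move/continuousP : ce => /(_ _ (@open_lt _ ((a' - a) / 2))).
move=> y /= xy; apply: (@lt_le_trans _ _ ((a + a') / 2)%:E).
  by rewrite lte_fin; lra.
apply/ereal_infP => _ [_ -> [b Sb <-]]; rewrite lee_fin.
have : a' <= enorm (x - b).
  rewrite -lee_fin; apply: (le_trans xa'); apply: ereal_inf_lbound.
  by exists x => //; exists b.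
have := enormD (x - y) (y - b); rewrite subrKA => h1 h2.
lra.
Qed.

Lemma nonstationary_gap x : grad f x != 0 -> (0 < gap [set x] (argmin f))%E.
Proof.
move=> /nonstationary_inff fx.
have lf := continuous_lsc _ (everywhere_differentiable_continuous f f_diff).
have [U xU Uf] : exists2 U, nbhs x U & forall y, U y -> (inff f < (f y)%:E)%E.
  move: fx; case: (inff f) => [m|//|_]; first exact: lf.
  by exists setT; [exact: filterT|move=> y _; exact: ltNyr].
have /nbhs_normP[e /= e0 eU] := xU.
apply: (@lt_le_trans _ _ e%:E); first by rewrite lte_fin.
apply/ereal_infP => _ [_ -> [b fb <-]]; rewrite lee_fin leNgt; apply/negP.
move=> /(le_lt_trans (norm_le_enorm _)) xb.
by have := Uf b (eU b xb); rewrite -fb ltxx.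
Qed.

Lemma lsc_norm_grad :
  lower_semicontinuous (fun x : 'rV[R]_n => (enorm (grad f x))%:E).
Proof.
apply: continuous_lsc; apply: enorm_comp_continuous => i.
exact: grad_continuous.
Qed.

End Semicontinuity.

Theorem theorem3p2 (R : realType) (n : nat) (n_ge1 : (1 <= n)%N)
    (d : measure_display) (T : measurableType d) (P : probability T R)
    (f : 'rV[R]_n -> R)
    (f_diff : forall x, differentiable (f : 'rV[R]_n -> R^o) x)
    (f_convex : convex_function [set: convex_lmodType 'rV[R]_n] f)
    (x0 : 'rV[R]_n) (alpha0 theta gamma : R)
    (alpha0_gt0 : 0 < alpha0) (theta_gt0 : 0 < theta) (theta_lt1 : theta < 1)
    (gamma_ge1 : 1 <= gamma)
    (rho : R -> R) (rho_forcing : forcing_function rho)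
    (c0 : R) (c0_ge : -1 <= c0) (c0_le : c0 <= 1)
    (D : nat -> T -> seq 'rV[R]_n) (X : nat -> T -> 'rV[R]_n)
    (A : nat -> T -> R)
    (pds : PDS f x0 alpha0 theta gamma rho D X A)
    (p : R) (p_ge0 : 0 <= p) (p_le1 : p <= 1)
    (ascent : probabilistic_ascent P f c0 D X p)
    (p_gt : ln gamma / ln (theta^-1 * gamma) < p) :
  (forall mu : 'rV[R]_n -> \bar R,
     (forall x, mu x != -oo%E) ->
     lower_semicontinuous mu ->
     (0 < mu x0)%E ->
     (0 < P [set w | (0 < ereal_inf [set mu (X k w) | k in [set: nat]])%E])%E)
  /\
  (grad f x0 != 0 ->
     [/\ (0 < P [set w | (0 < ereal_inf
            [set (f (X k w))%:E - inff f | k in [set: nat]])%E])%E,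
         (0 < P [set w | (0 < ereal_inf
            [set gap [set X k w] (argmin f) | k in [set: nat]])%E])%E &
         (0 < P [set w | (0 < ereal_inf
            [set (enorm (grad f (X k w)))%:E | k in [set: nat]])%E])%E]).
Proof.
have rho_gt0 : forall a, 0 < a -> 0 < rho a by case: rho_forcing.
have main (mu : 'rV[R]_n -> \bar R) :
    lower_semicontinuous mu -> (0 < mu x0)%E ->
    (0 < P [set w | (0 < ereal_inf [set mu (X k w) | k in [set: nat]])%E])%E.
  move=> lmu mu0.
  have [e e0 emu] : exists2 e : R, 0 < e & (e%:E < mu x0)%E.
    move: mu0; case: (mu x0) => [r| |//].
      by rewrite lte_fin => r0; exists (r / 2); rewrite ?lte_fin; lra.
    by move=> _; exists 1 => //; exact: ltry.
  have [U x0U Umu] := lmu _ _ emu.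
  have /nbhs_normP[delta /= delta0 dU] := x0U.
  have [|V [mV PV Vx]] := stay_close P f f_diff f_convex x0 alpha0 theta gamma
    alpha0_gt0 theta_gt0 theta_lt1 gamma_ge1 rho rho_gt0 c0 D X A pds p p_ge0
    p_le1 ascent p_gt (delta / 2); first by rewrite divr_gt0.
  apply: (lt_le_trans PV); rewrite le_measure ?inE//.
    exact: measurable_inf_gt0 (pds_X_random pds) lmu.
  move=> w Vw /=; apply: (@lt_le_trans _ _ e%:E); first by rewrite lte_fin.
  apply/ereal_infP => _ [k _ <-]; apply/ltW/Umu/dU => /=.
  by rewrite /ball_ distrC (le_lt_trans (Vx _ _ Vw))//; lra.
split=> [mu _|gx0]; first exact: main.
split.
- apply: (main (fun x => (f x)%:E - inff f)%E); first exact: lsc_subinff.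
  by rewrite sube_gt0; exact: nonstationary_inff.
- apply: (main (fun x => gap [set x] (argmin f))); first exact: lsc_gap.
  exact: nonstationary_gap.
- apply: (main (fun x => (enorm (grad f x))%:E)); first exact: lsc_norm_grad.
  by rewrite lte_fin lt_def enorm_ge0 enorm_eq0 gx0.
Qed.
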